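(* Consider the real planar cubic system \[ \dot\xi = P_3(y)+P_1(y)\xi,\qquad \dot y = -\xi - P_2(y), \] with \[ P_1(y)=a_0+a_1y,\qquad P_2(y)=b_1y+b_2y^2,\qquad P_3(y)=c_1y+c_2y^2+c_3y^3 . \] This system has a non-degenerate center at the origin if and only if $a_0-b_1=0$, $c_1-a_0b_1>0$, and at least one of the following holds: (i) $a_1-2b_2=0$ (Hamiltonian case); (ii) $c_2-a_0(a_1+b_2)=0$ (pull-back case).
   Context: A non-degenerate center is a singular point whose linearization has purely imaginary nonzero eigenvalues and whose nearby orbits are all closed. *)

(* Defs.v *)
From Stdlib Require Import Reals Lra.
Open Scope R_scope.

Definition is_solution (f g : R -> R -> R) (x y : R -> R) : Prop :=
  forall t, derivable_pt_lim x t (f (x t) (y t)) /\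
            derivable_pt_lim y t (g (x t) (y t)).

Definition singular_point (f g : R -> R -> R) (x0 y0 : R) : Prop :=
  f x0 y0 = 0 /\ g x0 y0 = 0.

Definition is_linearization (f g : R -> R -> R) (x0 y0 j11 j12 j21 j22 : R) : Prop :=
  derivable_pt_lim (fun u => f u y0) x0 j11 /\
  derivable_pt_lim (fun v => f x0 v) y0 j12 /\
  derivable_pt_lim (fun u => g u y0) x0 j21 /\
  derivable_pt_lim (fun v => g x0 v) y0 j22.

(* Complex numbers as pairs (re, im); the characteristic polynomial
   det(J - z I) = z^2 - (j11+j22) z + (j11 j22 - j12 j21) evaluated at z = re + i im
   is zero iff both its real and imaginary parts vanish. *)
Definition is_eigenvalue (j11 j12 j21 j22 re im : R) : Prop :=
  (re * re - im * im) - (j11 + j22) * re + (j11 * j22 - j12 * j21) = 0 /\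
  2 * re * im - (j11 + j22) * im = 0.

Definition purely_imaginary_nonzero_eigs (j11 j12 j21 j22 : R) : Prop :=
  forall re im, is_eigenvalue j11 j12 j21 j22 re im -> re = 0 /\ im <> 0.

Definition nearby_orbits_closed (f g : R -> R -> R) (x0 y0 : R) : Prop :=
  exists eps, 0 < eps /\
    forall p q, 0 < (p - x0)^2 + (q - y0)^2 < eps^2 ->
      exists (x y : R -> R) (T : R),
        0 < T /\ is_solution f g x y /\ x 0 = p /\ y 0 = q /\
        (forall t, x (t + T) = x t /\ y (t + T) = y t).

Definition nondegenerate_center (f g : R -> R -> R) (x0 y0 : R) : Prop :=
  singular_point f g x0 y0 /\
  (exists j11 j12 j21 j22, is_linearization f g x0 y0 j11 j12 j21 j22 /\
                           purely_imaginary_nonzero_eigs j11 j12 j21 j22) /\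
  nearby_orbits_closed f g x0 y0.

Definition P1 (a0 a1 y : R) : R := a0 + a1 * y.
Definition P2 (b1 b2 y : R) : R := b1 * y + b2 * y^2.
Definition P3 (c1 c2 c3 y : R) : R := c1 * y + c2 * y^2 + c3 * y^3.

Definition cubic_f (a0 a1 c1 c2 c3 : R) (xi y : R) : R :=
  P3 c1 c2 c3 y + P1 a0 a1 y * xi.
Definition cubic_g (b1 b2 : R) (xi y : R) : R :=
  - xi - P2 b1 b2 y.

(* Main.v *)
Require Import Defs.
From Stdlib Require Import Reals ZArith Lra Lia Factorial Ranalysis5 Classical_Prop.
From Coquelicot Require Import Coquelicot.
Open Scope R_scope.

(* The linearization at the origin has trace a0 - b1 and determinant c1 - a0 b1.
   With u = xi + P2(y) and a0 = b1 the system becomes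
     y' = - u,  u' = om y + be y^2 + ga y^3 + al y u,
   where om = c1 - a0 b1, al = a1 - 2 b2, be = c2 - a0 (a1 + b2), ga = c3 - a1 b2.

   If al = 0 or be = 0, this field is reversible with respect to u -> - u or
   y -> - y. Truncating the nonlinear part makes the field globally Lipschitz and
   uniformly rotating without losing the symmetry, so every orbit meets the axis of
   symmetry twice within a fixed time and is therefore periodic, with bounded period.
   By Gronwall's inequality, small orbits stay where the truncation is inactive.

   If al be <> 0, the variable w = u + al y^2 / 2 gives y' = - w + al y^2 / 2,
   w' = om y + be y^2 + ga y^3, for which an explicit quartic Lyapunov function is
   strictly monotone along small nonzero orbits; none of them is periodic. *)

(** * Global solutions of Lipschitz systems *)

(** Inductive step of the Picard estimates: integrating from [0] raises both the power and the
    factorial by one. Negative [t] is reduced to positive [t] by the substitution [s -> - s]. *)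
Lemma RInt_0_abs_le_pow (h : R -> R) (C : R) (n : nat) :
  (forall s, continuous h s) ->
  (forall s, Rabs (h s) <= C * (Rabs s ^ n / INR (fact n))) ->
  forall t, Rabs (RInt h 0 t) <= C * (Rabs t ^ S n / INR (fact (S n))).
Proof.
  assert (pos : forall (h : R -> R), (forall s, continuous h s) ->
    (forall s, Rabs (h s) <= C * (Rabs s ^ n / INR (fact n))) ->
    forall t, 0 <= t -> Rabs (RInt h 0 t) <= C * (t ^ S n / INR (fact (S n)))).
  { intros k kc kb t t0.
    assert (I : is_RInt (fun s => C * (s ^ n / INR (fact n))) 0 t
                  (C * (t ^ S n / INR (fact (S n))))).
    { replace (C * (t ^ S n / INR (fact (S n)))) with
        (minus (C * (t ^ S n / INR (fact (S n)))) (C * (0 ^ S n / INR (fact (S n))))).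
      2:{ unfold minus, plus, opp; simpl. unfold Rdiv. ring. }
      apply (is_RInt_derive (fun s => C * (s ^ S n / INR (fact (S n))))).
      - intros s _.
        assert (INR (fact n) <> 0) by apply INR_fact_neq_0.
        assert (INR (S n) <> 0) by (apply not_0_INR; lia).
        rewrite fact_simpl, mult_INR.
        auto_derive; [exact I|].
        replace (match n with O => 1 | S _ => INR n + 1 end) with (INR (S n)) by reflexivity.
        simpl pred. field. auto.
      - intros s _. apply (ex_derive_continuous (fun s => C * (s ^ n / INR (fact n)))).
        auto_derive. exact I. }
    apply (norm_RInt_le k (fun s => C * (s ^ n / INR (fact n))) 0 t); trivial.
    - intros s [s0 _]. specialize (kb s). rewrite (Rabs_pos_eq s) in kb by exact s0. exact kb.
    - apply (RInt_correct k), (ex_RInt_continuous k). intros; apply kc. }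
  intros hc hb t.
  destruct (Rle_dec 0 t) as [t0|t0].
  - rewrite (Rabs_pos_eq t) by exact t0. auto.
  - rewrite (Rabs_left t) by lra.
    assert (E : RInt h 0 t = - RInt (fun s => h (- s)) 0 (- t)).
    { assert (H : is_RInt (fun s => opp (h (- s))) 0 (- t) (RInt h 0 t)).
      { apply (is_RInt_comp_opp h). rewrite Ropp_0, Ropp_involutive.
        apply (RInt_correct h), (ex_RInt_continuous h). intros; apply hc. }
      apply is_RInt_opp in H.
      apply (is_RInt_ext _ (fun s => h (- s))) in H.
      2:{ intros s _. unfold opp; simpl. ring. }
      rewrite (is_RInt_unique (fun s => h (- s)) _ _ _ H).
      symmetry; apply Ropp_involutive. }
    rewrite E, Rabs_Ropp.
    apply pos; [| |lra].
    + intros s. apply (continuous_comp Ropp h); [|apply hc].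
      apply (ex_derive_continuous Ropp). auto_derive. exact I.
    + intros s. rewrite <- (Rabs_Ropp s). apply hb.
Qed.

Definition lipschitz2 (L : R) (f : R -> R -> R) : Prop :=
  forall x y x' y', Rabs (f x y - f x' y') <= L * (Rabs (x - x') + Rabs (y - y')).

Lemma lipschitz2_comp_continuous (L : R) (f : R -> R -> R) (x y : R -> R) (t : R) :
  lipschitz2 L f -> continuity_pt x t -> continuity_pt y t ->
  continuity_pt (fun s => f (x s) (y s)) t.
Proof.
  intros Lf cx cy.
  assert (L0 : 0 <= L).
  { specialize (Lf 1 0 0 0). rewrite !Rminus_0_r, Rabs_R1, Rabs_R0 in Lf.
    generalize (Rabs_pos (f 1 0 - f 0 0)). lra. }
  intros e e0.
  assert (e1 : e / (2 * (L + 1)) > 0).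
  { apply Rdiv_lt_0_compat; lra. }
  destruct (cx _ e1) as [d1 [p1 H1]]. destruct (cy _ e1) as [d2 [p2 H2]].
  exists (Rmin d1 d2). split; [now apply Rmin_pos|].
  intros s [Ds Hs]. simpl in *. unfold R_dist in *.
  assert (A1 := H1 s (conj Ds (Rlt_le_trans _ _ _ Hs (Rmin_l _ _)))).
  assert (A2 := H2 s (conj Ds (Rlt_le_trans _ _ _ Hs (Rmin_r _ _)))).
  apply Rle_lt_trans with (1 := Lf _ _ _ _).
  apply Rle_lt_trans with (L * (e / (L + 1))).
  - apply Rmult_le_compat_l; trivial.
    replace (e / (L + 1)) with (e / (2 * (L + 1)) + e / (2 * (L + 1))) by (field; lra). lra.
  - apply Rlt_le_trans with ((L + 1) * (e / (L + 1))).
    + apply Rmult_lt_compat_r; [|lra]. apply Rdiv_lt_0_compat; lra.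
    + right. field. lra.
Qed.

Lemma is_derive_RInt_shift (h : R -> R) (a t : R) :
  (forall s, continuous h s) -> is_derive (fun t => a + RInt h 0 t) t (h t).
Proof.
  intros hc.
  apply is_derive_ext with (fun t => plus a (RInt h 0 t)); [reflexivity|].
  replace (h t) with (plus zero (h t)) by (unfold plus, zero; simpl; ring).
  apply (@is_derive_plus R_AbsRing R_NormedModule); [apply (@is_derive_const R_AbsRing R_NormedModule)|].
  apply is_derive_RInt with 0; [|apply hc].
  exists (mkposreal 1 Rlt_0_1). intros s _.
  apply (RInt_correct h), (ex_RInt_continuous h). intros; apply hc.
Qed.

(** Terms of a telescoping series with partial sums [Z n]; they bring the sequence [Z] within reach
    of the Weierstrass M-test, which [CVN_R] states for series. *)
Definition increments (Z : nat -> R -> R) (n : nat) (t : R) : R :=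
  match n with O => Z O t | S m => Z (S m) t - Z m t end.

Lemma SP_increments Z n t : SP (increments Z) n t = Z n t.
Proof.
  unfold SP. induction n as [|n IH]; simpl in *; [reflexivity|]. rewrite IH. ring.
Qed.

Lemma CVU_ext (F G : nat -> R -> R) h c r :
  (forall n t, F n t = G n t) -> CVU F h c r -> CVU G h c r.
Proof.
  intros E H e e0. destruct (H e e0) as [N HN]. exists N. intros n y Hn Hy.
  rewrite <- E. now apply HN.
Qed.

Lemma increments_limit (Z : nat -> R -> R) :
  CVN_R (increments Z) -> exists z, forall r : posreal, CVU Z z 0 r.
Proof.
  intros H. exists (SFL (increments Z) (CVN_R_CVS _ H)).
  intros r. apply CVU_ext with (SP (increments Z)); [apply SP_increments|].
  apply CVN_CVU, H.
Qed.

Section Picard.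

Variables (f g : R -> R -> R) (L p q : R).
Hypotheses (Lf : lipschitz2 L f) (Lg : lipschitz2 L g).

Fixpoint picard_iter (n : nat) : (R -> R) * (R -> R) :=
  match n with
  | O => (fun _ => p, fun _ => q)
  | S m =>
      let z := picard_iter m in
      (fun t => p + RInt (fun s => f (fst z s) (snd z s)) 0 t,
       fun t => q + RInt (fun s => g (fst z s) (snd z s)) 0 t)
  end.

Let X n := fst (picard_iter n).
Let Y n := snd (picard_iter n).

Lemma picard_iter_continuous n t :
  continuity_pt (X n) t /\ continuity_pt (Y n) t.
Proof.
  revert t. induction n as [|n IH]; intros t.
  - split; apply continuity_pt_const; intros ? ?; reflexivity.
  - assert (C : forall h, lipschitz2 L h -> forall s, continuous (fun s => h (X n s) (Y n s)) s).
    { intros h Lh s. apply continuity_pt_filterlim.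
      apply lipschitz2_comp_continuous with L; trivial; apply IH. }
    split; apply continuity_pt_filterlim.
    + apply (ex_derive_continuous (X (S n))). eexists. apply (is_derive_RInt_shift _ _ _ (C f Lf)).
    + apply (ex_derive_continuous (Y (S n))). eexists. apply (is_derive_RInt_shift _ _ _ (C g Lg)).
Qed.

Lemma picard_field_continuous h n t :
  lipschitz2 L h -> continuous (fun s => h (X n s) (Y n s)) t.
Proof.
  intros Lh. apply continuity_pt_filterlim.
  apply lipschitz2_comp_continuous with L; trivial; apply picard_iter_continuous.
Qed.

Lemma picard_iter_derive n t :
  derivable_pt_lim (X (S n)) t (f (X n t) (Y n t)) /\
  derivable_pt_lim (Y (S n)) t (g (X n t) (Y n t)).
Proof.
  split; apply is_derive_Reals.
  - apply (is_derive_RInt_shift (fun s => f (X n s) (Y n s))).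
    intros; now apply picard_field_continuous.
  - apply (is_derive_RInt_shift (fun s => g (X n s) (Y n s))).
    intros; now apply picard_field_continuous.
Qed.

(** [M] dominates both the starting point, which is the zeroth increment, and the field there, which
    governs the first one. In [K], the factor [2] accounts for the two components entering the
    Lipschitz bound, and the [1] gives [K >= 1], needed for the first step. *)
Let M := Rabs p + Rabs q + Rabs (f p q) + Rabs (g p q).
Let K := 2 * Rabs L + 1.

Lemma picard_step_le n t :
  Rabs (X (S n) t - X n t) <= M * ((K * Rabs t) ^ S n / INR (fact (S n))) /\
  Rabs (Y (S n) t - Y n t) <= M * ((K * Rabs t) ^ S n / INR (fact (S n))).
Proof.
  assert (M0 : 0 <= M /\ Rabs (f p q) <= M /\ Rabs (g p q) <= M).
  { unfold M. generalize (Rabs_pos p) (Rabs_pos q) (Rabs_pos (f p q)) (Rabs_pos (g p q)). lra. }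
  assert (K1 : 1 <= K) by (unfold K; generalize (Rabs_pos L); lra).
  revert t. induction n as [|n IH]; intros t.
  - assert (A : forall h a, Rabs (h p q) <= M ->
      Rabs (a + RInt (fun _ => h p q) 0 t - a) <= M * ((K * Rabs t) ^ 1 / INR (fact 1))).
    { intros h a hM. rewrite RInt_const. unfold scal; simpl; unfold mult; simpl.
      replace (a + (t - 0) * h p q - a) with (t * h p q) by ring.
      rewrite Rabs_mult. assert (T := Rabs_pos t).
      replace (M * (K * Rabs t * 1 / 1)) with (Rabs t * (K * M)) by field.
      apply Rmult_le_compat_l; trivial. nra. }
    split; [apply (A f p)|apply (A g q)]; apply M0.
  - assert (A : forall h a, lipschitz2 L h ->
      Rabs ((a + RInt (fun s => h (X (S n) s) (Y (S n) s)) 0 t) -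
            (a + RInt (fun s => h (X n s) (Y n s)) 0 t))
        <= M * ((K * Rabs t) ^ S (S n) / INR (fact (S (S n))))).
    { intros h a Lh.
      assert (E : forall m, ex_RInt (fun s => h (X m s) (Y m s)) 0 t).
      { intros m. apply (ex_RInt_continuous (fun s => h (X m s) (Y m s))).
        intros; now apply picard_field_continuous. }
      replace (_ - _) with (RInt (fun s => h (X (S n) s) (Y (S n) s) - h (X n s) (Y n s)) 0 t).
      2:{ rewrite (RInt_minus (fun s => h (X (S n) s) (Y (S n) s)) (fun s => h (X n s) (Y n s)));
          try apply E. unfold minus, plus, opp; simpl. ring. }
      apply Rle_trans with ((M * K ^ S (S n)) * (Rabs t ^ S (S n) / INR (fact (S (S n))))).
      2:{ right. rewrite Rpow_mult_distr. unfold Rdiv. ring. }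
      apply (RInt_0_abs_le_pow (fun s => h (X (S n) s) (Y (S n) s) - h (X n s) (Y n s))).
      - intros s. apply (continuous_minus (fun s => h (X (S n) s) (Y (S n) s)));
        now apply picard_field_continuous.
      - intros s. destruct (IH s) as [I1 I2].
        apply Rle_trans with (1 := Lh _ _ _ _).
        rewrite Rpow_mult_distr in I1, I2.
        (* Both components of the previous step are at most [F], so the field changes by at most
           [Rabs L * (F + F) <= K * F]. *)
        set (F := M * (K ^ S n * Rabs s ^ S n / INR (fact (S n)))) in *.
        replace (M * K ^ S (S n) * (Rabs s ^ S n / INR (fact (S n)))) with (K * F).
        2:{ unfold F. simpl pow. unfold Rdiv. ring. }
        assert (0 <= F) by (generalize (Rabs_pos (X (S n) s - X n s)); lra).
        assert (L <= Rabs L) by apply Rle_abs.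
        apply Rle_trans with (Rabs L * (F + F)).
        + generalize (Rabs_pos (X (S n) s - X n s)) (Rabs_pos (Y (S n) s - Y n s)) (Rabs_pos L).
          intros. apply Rmult_le_compat; try lra.
          * destruct (Rle_dec 0 L); [trivial|].
            exfalso. generalize (Lh 1 0 0 0). rewrite !Rminus_0_r, Rabs_R1, Rabs_R0.
            generalize (Rabs_pos (h 1 0 - h 0 0)). lra.
        + unfold K. nra. }
    split; [apply (A f p Lf)|apply (A g q Lg)].
Qed.

(** On the ball of radius [r] the increments are dominated by the terms of the exponential series,
    with sum [M * exp (K * r)]. *)
Lemma CVN_increments (Z : nat -> R -> R) :
  (forall t, Rabs (Z O t) <= M) ->
  (forall n t, Rabs (Z (S n) t - Z n t) <= M * ((K * Rabs t) ^ S n / INR (fact (S n)))) ->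
  CVN_R (increments Z).
Proof.
  intros H0 HS r.
  assert (M0 : 0 <= M) by (generalize (Rabs_pos (Z O 0)) (H0 0); lra).
  assert (K1 : 1 <= K) by (unfold K; generalize (Rabs_pos L); lra).
  assert (r0 := cond_pos r).
  set (A := fun n => M * (/ INR (fact n) * (K * r) ^ n)).
  assert (A0 : forall n, 0 <= A n).
  { intros n. unfold A. apply Rmult_le_pos; trivial.
    apply Rmult_le_pos; [left; apply Rinv_0_lt_compat, INR_fact_lt_0|].
    apply pow_le. nra. }
  exists A. exists (M * exp (K * r)). split.
  - apply Un_cv_ext with (fun n => M * sum_f_R0 (fun k => / INR (fact k) * (K * r) ^ k) n).
    { intros n. rewrite scal_sum. apply sum_eq. intros i _.
      rewrite Rabs_pos_eq by apply A0. unfold A. ring. }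
    apply CV_mult; [|exact (proj2_sig (exist_exp (K * r)))].
    intros e e0. exists O. intros. unfold Rdist. rewrite Rminus_diag, Rabs_R0. exact e0.
  - intros [|n] t Ht; unfold increments.
    + unfold A. simpl. rewrite Rinv_1, !Rmult_1_r. apply H0.
    + apply Rle_trans with (1 := HS n t). unfold A.
      apply Rmult_le_compat_l; trivial. unfold Rdiv. rewrite Rmult_comm.
      apply Rmult_le_compat_l; [left; apply Rinv_0_lt_compat, INR_fact_lt_0|].
      unfold Boule in Ht. rewrite Rminus_0_r in Ht.
      apply pow_incr. generalize (Rabs_pos t). nra.
Qed.

Lemma CVU_lipschitz2 h (x y : R -> R) r :
  lipschitz2 L h -> CVU X x 0 r -> CVU Y y 0 r ->
  CVU (fun n t => h (X n t) (Y n t)) (fun t => h (x t) (y t)) 0 r.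
Proof.
  intros Lh Hx Hy e e0.
  assert (L0 := Rabs_pos L).
  assert (e1 : 0 < e / (2 * (Rabs L + 1))) by (apply Rdiv_lt_0_compat; lra).
  destruct (Hx _ e1) as [N1 H1]. destruct (Hy _ e1) as [N2 H2].
  exists (N1 + N2)%nat. intros n t Hn Ht.
  assert (B1 := H1 n t ltac:(lia) Ht). assert (B2 := H2 n t ltac:(lia) Ht).
  apply Rle_lt_trans with (1 := Lh _ _ _ _).
  set (d := e / (2 * (Rabs L + 1))) in *.
  replace e with ((Rabs L + 1) * (d + d)) by (unfold d; field; lra).
  generalize (Rle_abs L) (Rabs_pos (x t - X n t)) (Rabs_pos (y t - Y n t)). nra.
Qed.

(** On every bounded interval the Picard iterates converge uniformly, and so do their derivatives by
    the Lipschitz property; the limit may therefore be differentiated termwise. *)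
Lemma lipschitz_solution_exists :
  exists x y, is_solution f g x y /\ x 0 = p /\ y 0 = q.
Proof.
  destruct (increments_limit X) as [x Hx].
  { apply CVN_increments; [|intros; apply picard_step_le].
    intros t. unfold X, M; simpl.
    generalize (Rabs_pos q) (Rabs_pos (f p q)) (Rabs_pos (g p q)); lra. }
  destruct (increments_limit Y) as [y Hy].
  { apply CVN_increments; [|intros; apply picard_step_le].
    intros t. unfold Y, M; simpl.
    generalize (Rabs_pos p) (Rabs_pos (f p q)) (Rabs_pos (g p q)); lra. }
  assert (cv : forall Z z, (forall r : posreal, CVU Z z 0 r) ->
     forall t, Un_cv (fun n => Z n t) (z t)).
  { intros Z z H t e e0.
    assert (r0 : 0 < Rabs t + 1) by (generalize (Rabs_pos t); lra).
    destruct (H (mkposreal _ r0) e e0) as [N HN]. exists N. intros n Hn.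
    unfold Rdist. rewrite Rabs_minus_sym. apply HN; trivial.
    unfold Boule; simpl. rewrite Rminus_0_r. lra. }
  assert (ct : forall Z z, (forall r : posreal, CVU Z z 0 r) ->
     (forall n t, continuity_pt (Z n) t) -> forall t, continuity_pt z t).
  { intros Z z H C t.
    assert (r0 : 0 < Rabs t + 1) by (generalize (Rabs_pos t); lra).
    apply (CVU_continuity Z z 0 (mkposreal _ r0) (H _)).
    - intros; apply C.
    - unfold Boule; simpl. rewrite Rminus_0_r. lra. }
  assert (dv : forall Z z h, lipschitz2 L h -> (forall r : posreal, CVU Z z 0 r) ->
     (forall n t, derivable_pt_lim (Z (S n)) t (h (X n t) (Y n t))) ->
     forall t, derivable_pt_lim z t (h (x t) (y t))).
  { intros Z z h Lh H D t.
    assert (r0 : 0 < Rabs t + 1) by (generalize (Rabs_pos t); lra).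
    (* The sequence is shifted by one because iterate [S n] has as derivative the field along
       iterate [n]. *)
    apply (derivable_pt_lim_CVU (fun n => Z (S n)) (fun n t => h (X n t) (Y n t))
             z (fun t => h (x t) (y t)) t 0 (mkposreal _ r0)).
    - unfold Boule; simpl. rewrite Rminus_0_r. lra.
    - intros; apply D.
    - intros s _ e e0. destruct (cv Z z H s e e0) as [N HN].
      exists N. intros n Hn. apply HN. lia.
    - now apply CVU_lipschitz2.
    - intros s _. apply lipschitz2_comp_continuous with L; trivial.
      + apply ct with X; trivial. intros; apply picard_iter_continuous.
      + apply ct with Y; trivial. intros; apply picard_iter_continuous. }
  assert (in0 : forall (Z : nat -> R -> R) z a, (forall r : posreal, CVU Z z 0 r) -> (forall n, Z n 0 = a) -> z 0 = a).
  { intros Z z a H E. apply UL_sequence with (fun n => Z n 0); [now apply cv|].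
    intros e e0. exists O. intros n _. unfold Rdist. rewrite E, Rminus_diag, Rabs_R0. exact e0. }
  exists x, y. split; [|split].
  - intros t. split.
    + apply dv with X; trivial. intros; apply picard_iter_derive.
    + apply dv with Y; trivial. intros; apply picard_iter_derive.
  - apply in0 with X; trivial. intros [|n]; unfold X; simpl; trivial.
    rewrite RInt_point. unfold zero; simpl. ring.
  - apply in0 with Y; trivial. intros [|n]; unfold Y; simpl; trivial.
    rewrite RInt_point. unfold zero; simpl. ring.
Qed.

End Picard.

(** * Gronwall's inequality, uniqueness of solutions and rotation *)

Ltac derive_by_hyps :=
  auto_derive; [repeat split; trivial; eexists; eassumption|];
  (* For an abstract function [auto_derive] leaves [Derive x z] in the result; its value is taken
     from the hypotheses. *)
  repeat match goal with
  | D : is_derive ?x ?z ?l |- context [Derive ?x' ?z'] =>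
      replace (Derive x' z') with l by (symmetry; apply is_derive_unique; exact D)
  end.

(** By the mean value theorem, [N z * exp (- k * z)] does not increase, which settles [s < t], and
    [N z * exp (k * z)] does not decrease, which settles [t < s]. *)
Lemma gronwall_exp (N dN : R -> R) (k : R) :
  (forall t, derivable_pt_lim N t (dN t)) ->
  (forall t, Rabs (dN t) <= k * N t) ->
  forall s t, N t <= N s * exp (k * Rabs (t - s)).
Proof.
  intros D B s t.
  assert (DE : forall c z, derivable_pt_lim (fun z => N z * exp (c * z)) z
                             ((dN z + c * N z) * exp (c * z))).
  { intros c z. apply is_derive_Reals. specialize (D z). apply is_derive_Reals in D.
    derive_by_hyps. ring. }
  assert (B' : forall z, - (k * N z) <= dN z <= k * N z).
  { intros z. now apply Rabs_le_between. }
  destruct (Rtotal_order s t) as [st|[<-|ts]].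
  - rewrite Rabs_pos_eq by lra.
    destruct (MVT_cor2 _ _ s t st (fun z _ => DE (- k) z)) as [z [E _]].
    assert (0 < exp (- k * z)) by apply exp_pos. specialize (B' z).
    assert (Q : (dN z + - k * N z) * exp (- k * z) <= 0) by nra.
    assert (H1 : N t * exp (- k * t) <= N s * exp (- k * s)) by nra.
    apply Rmult_le_compat_r with (r := exp (k * t)) in H1; [|left; apply exp_pos].
    rewrite !Rmult_assoc, <- !exp_plus in H1.
    replace (- k * t + k * t) with 0 in H1 by ring. rewrite exp_0 in H1.
    replace (k * (t - s)) with (- k * s + k * t) by ring. lra.
  - rewrite Rminus_diag, Rabs_R0, Rmult_0_r, exp_0. lra.
  - rewrite Rabs_left by lra.
    destruct (MVT_cor2 _ _ t s ts (fun z _ => DE k z)) as [z [E _]].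
    assert (0 < exp (k * z)) by apply exp_pos. specialize (B' z).
    assert (Q : 0 <= (dN z + k * N z) * exp (k * z)) by (apply Rmult_le_pos; lra).
    assert (H1 : N t * exp (k * t) <= N s * exp (k * s)) by nra.
    apply Rmult_le_compat_r with (r := exp (- k * t)) in H1; [|left; apply exp_pos].
    rewrite !Rmult_assoc, <- !exp_plus in H1.
    replace (k * t + - k * t) with 0 in H1 by ring. rewrite exp_0 in H1.
    replace (k * - (t - s)) with (k * s + - k * t) by ring. lra.
Qed.

(** The squared distance is differentiable. With [a] and [b] the coordinate differences in absolute
    value, its derivative is at most [2 * L * (a + b) ^ 2 <= 4 * L * (a ^ 2 + b ^ 2)], so Gronwall
    applies. *)
Lemma solution_distance_le (f g : R -> R -> R) (L : R) (x y x' y' : R -> R) :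
  lipschitz2 L f -> lipschitz2 L g ->
  is_solution f g x y -> is_solution f g x' y' ->
  forall s t, (x t - x' t) ^ 2 + (y t - y' t) ^ 2 <=
    ((x s - x' s) ^ 2 + (y s - y' s) ^ 2) * exp (4 * L * Rabs (t - s)).
Proof.
  intros Lf Lg S S' s t.
  apply (gronwall_exp (fun t => (x t - x' t) ^ 2 + (y t - y' t) ^ 2)
    (fun t => 2 * (x t - x' t) * (f (x t) (y t) - f (x' t) (y' t)) +
              2 * (y t - y' t) * (g (x t) (y t) - g (x' t) (y' t)))).
  - intros z. destruct (S z) as [D1 D2], (S' z) as [D3 D4].
    apply is_derive_Reals in D1, D2, D3, D4. apply is_derive_Reals.
    derive_by_hyps. ring.
  - intros z. specialize (Lf (x z) (y z) (x' z) (y' z)). specialize (Lg (x z) (y z) (x' z) (y' z)).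
    set (F := f (x z) (y z) - _) in *. set (G := g (x z) (y z) - _) in *.
    rewrite <- (pow2_abs (x z - x' z)), <- (pow2_abs (y z - y' z)).
    eapply Rle_trans; [apply Rabs_triang|]. rewrite !Rabs_mult, (Rabs_pos_eq 2) by lra.
    set (a := Rabs (x z - x' z)) in *. set (b := Rabs (y z - y' z)) in *.
    assert (0 <= a) by apply Rabs_pos. assert (0 <= b) by apply Rabs_pos.
    assert (0 <= L * (a + b)) by (generalize (Rabs_pos F); lra).
    apply Rle_trans with (2 * (L * (a + b)) * (a + b)); [nra|].
    assert (0 <= (a - b) ^ 2) by apply pow2_ge_0.
    (* The sign of [L] can be read off [0 <= L * (a + b)] only when [a + b] is nonzero; otherwise
       both sides vanish. *)
    destruct (Req_dec (a + b) 0) as [ab|ab]; [|assert (0 <= L) by nra; nra].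
    assert (a = 0) by lra. assert (b = 0) by lra. nra.
Qed.

Lemma lipschitz_solution_unique (f g : R -> R -> R) (L : R) (x y x' y' : R -> R) (s : R) :
  lipschitz2 L f -> lipschitz2 L g ->
  is_solution f g x y -> is_solution f g x' y' ->
  x s = x' s -> y s = y' s -> forall t, x t = x' t /\ y t = y' t.
Proof.
  intros Lf Lg S S' Ex Ey t.
  assert (H := solution_distance_le f g L x y x' y' Lf Lg S S' s t).
  rewrite Ex, Ey, !Rminus_diag in H.
  assert (0 <= (x t - x' t) ^ 2) by apply pow2_ge_0.
  assert (0 <= (y t - y' t) ^ 2) by apply pow2_ge_0.
  split; apply Rminus_diag_uniq; apply Rsqr_0_uniq; unfold Rsqr; nra.
Qed.

(** The angular velocity is at least [k]. If [Y] had no zero on the interval, [atan (X / Y)] would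
    be differentiable there with slope at most [- k] and would drop by at least [2 * PI], although
    its values lie in an interval of length [PI]. *)
Lemma rotation_hits_axis (X Y dX dY : R -> R) (k : R) :
  0 < k ->
  (forall t, derivable_pt_lim X t (dX t)) -> (forall t, derivable_pt_lim Y t (dY t)) ->
  (forall t, k * (X t ^ 2 + Y t ^ 2) <= X t * dY t - Y t * dX t) ->
  forall a, exists t, a <= t <= a + 2 * PI / k /\ Y t = 0.
Proof.
  intros k0 DX DY H a.
  apply NNPP. intros NZ.
  assert (nz : forall t, a <= t <= a + 2 * PI / k -> Y t <> 0).
  { intros t It E. apply NZ. now exists t. }
  assert (pi0 := PI_RGT_0).
  assert (len : 0 < 2 * PI / k) by (apply Rdiv_lt_0_compat; lra).
  destruct (MVT_cor2 (fun t => atan (X t / Y t))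
    (fun t => - (X t * dY t - Y t * dX t) / (X t ^ 2 + Y t ^ 2)) a (a + 2 * PI / k))
    as [c [E Ic]]; [lra| |].
  - intros t It. specialize (nz t It).
    specialize (DX t). specialize (DY t). apply is_derive_Reals in DX, DY. apply is_derive_Reals.
    derive_by_hyps.
    assert (0 < Y t ^ 2) by (apply pow2_gt_0; exact nz).
    assert (0 <= X t ^ 2) by apply pow2_ge_0.
    field. repeat split; trivial; nra.
  - assert (Yc := nz c ltac:(lra)).
    assert (0 < Y c ^ 2) by (apply pow2_gt_0; exact Yc).
    assert (0 <= X c ^ 2) by apply pow2_ge_0.
    assert (B : - (X c * dY c - Y c * dX c) / (X c ^ 2 + Y c ^ 2) <= - k).
    { apply Rmult_le_reg_r with (X c ^ 2 + Y c ^ 2); [lra|].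
      unfold Rdiv. rewrite Rmult_assoc, Rinv_l by lra. specialize (H c). lra. }
    assert (B1 := atan_bound (X a / Y a)).
    assert (B2 := atan_bound (X (a + 2 * PI / k) / Y (a + 2 * PI / k))).
    replace (a + 2 * PI / k - a) with (2 * PI / k) in E by ring.
    apply Rmult_le_compat_r with (r := 2 * PI / k) in B; [|lra].
    replace (- k * (2 * PI / k)) with (- (2 * PI)) in B by (field; lra). lra.
Qed.

(** * Reversible rotations *)

(* The reversor [(x, y) |-> (e x, - e y)] with [e = 1] or [e = -1] covers
   reflections in either coordinate axis. *)
Definition reversible (e : R) (f g : R -> R -> R) : Prop :=
  forall x y, f (e * x) (- e * y) = - e * f x y /\ g (e * x) (- e * y) = e * g x y.

(** Reversing time about [s] and applying the reversor yields another solution. It agrees with the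
    given one at time [s], where the orbit is on the axis of symmetry, so uniqueness identifies the
    two. *)
Lemma reversible_reflect (f g : R -> R -> R) (L e s : R) (x y : R -> R) :
  lipschitz2 L f -> lipschitz2 L g -> reversible e f g ->
  is_solution f g x y -> e * x s = x s -> - e * y s = y s ->
  forall t, x t = e * x (2 * s - t) /\ y t = - e * y (2 * s - t).
Proof.
  intros Lf Lg R S Ex Ey.
  apply (lipschitz_solution_unique f g L x y
    (fun t => e * x (2 * s - t)) (fun t => - e * y (2 * s - t)) s); trivial.
  - intros t. destruct (R (x (2 * s - t)) (y (2 * s - t))) as [Rf Rg]. rewrite Rf, Rg.
    destruct (S (2 * s - t)) as [D1 D2]. apply is_derive_Reals in D1, D2.
    split; apply is_derive_Reals.
    + derive_by_hyps. ring.
    + derive_by_hyps. ring.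
  - replace (2 * s - s) with s by ring. now rewrite Ex.
  - replace (2 * s - s) with s by ring. now rewrite Ey.
Qed.

(* Composing the reflections about two times at which the orbit meets the
   axis of symmetry gives a translation by twice their difference. *)
Lemma reversible_rotation_periodic (f g : R -> R -> R) (L e k : R) (x y : R -> R) :
  lipschitz2 L f -> lipschitz2 L g -> e = 1 \/ e = -1 -> reversible e f g ->
  0 < k -> (forall u v, k * (u ^ 2 + v ^ 2) <= u * g u v - v * f u v) ->
  is_solution f g x y ->
  exists T, 0 < T <= 12 * PI / k /\ forall t, x (t + T) = x t /\ y (t + T) = y t.
Proof.
  intros Lf Lg e1 R k0 H S.
  assert (hit : forall a, exists t, a <= t <= a + 2 * PI / k /\ e * x t = x t /\ - e * y t = y t).
  { intros a. destruct e1 as [->| ->].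
    - destruct (rotation_hits_axis x y (fun t => f (x t) (y t)) (fun t => g (x t) (y t)) k)
        with (a := a) as [t [It E]]; trivial; try (intros; apply S).
      exists t. rewrite E. split; trivial. lra.
    (* The axis is now [x = 0]: a quarter turn to the pair [(y, - x)] preserves the angular
       velocity. *)
    - destruct (rotation_hits_axis y (fun t => - x t) (fun t => g (x t) (y t))
        (fun t => - f (x t) (y t)) k) with (a := a) as [t [It E]]; trivial; try (intros; apply S).
      { intros t. apply (derivable_pt_lim_opp x), S. }
      { intros t. specialize (H (x t) (y t)). nra. }
      exists t. replace (x t) with 0 by lra. split; trivial. lra. }
  assert (pi0 := PI_RGT_0).
  assert (len : 0 < 2 * PI / k) by (apply Rdiv_lt_0_compat; lra).
  replace (12 * PI / k) with (6 * (2 * PI / k)) by (field; lra).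
  set (A := 2 * PI / k) in *.
  (* The windows [[0, A]] and [[2 * A, 3 * A]] are disjoint, so [A <= t2 - t1 <= 3 * A]: the period
     is positive and at most [6 * A]. *)
  destruct (hit 0) as [t1 [I1 [E1 F1]]]. destruct (hit (2 * A)) as [t2 [I2 [E2 F2]]].
  exists (2 * (t2 - t1)). split; [lra|]. intros t.
  destruct (reversible_reflect f g L e t1 x y Lf Lg R S E1 F1 t) as [-> ->].
  destruct (reversible_reflect f g L e t2 x y Lf Lg R S E2 F2 (t + 2 * (t2 - t1))) as [-> ->].
  replace (2 * t2 - (t + 2 * (t2 - t1))) with (2 * t1 - t) by ring. auto.
Qed.

(** Extends to all times a bound that Gronwall's inequality gives on a single period. *)
Lemma periodic_reduce (x y : R -> R) (T : R) :
  0 < T -> (forall t, x (t + T) = x t /\ y (t + T) = y t) ->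
  forall t, exists s, 0 <= s <= T /\ x s = x t /\ y s = y t.
Proof.
  intros T0 H t.
  assert (P : forall n s, x (s + INR n * T) = x s /\ y (s + INR n * T) = y s).
  { induction n as [|n IH]; intros s.
    - simpl. now rewrite Rmult_0_l, Rplus_0_r.
    - rewrite S_INR. replace (s + (INR n + 1) * T) with (s + INR n * T + T) by ring.
      destruct (H (s + INR n * T)) as [-> ->]. apply IH. }
  destruct (base_Int_part (t / T)) as [B1 B2].
  set (z := Int_part (t / T)) in *.
  assert (I : 0 <= t - IZR z * T <= T).
  { assert (E : t = t / T * T) by (field; lra).
    assert (0 <= (t / T - IZR z) * T <= T) by nra. lra. }
  exists (t - IZR z * T). split; trivial.
  destruct (Z_le_dec 0 z) as [z0|z0].
  - rewrite <- (Z2Nat.id z) by trivial. rewrite <- INR_IZR_INZ.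
    set (s := t - _). replace t with (s + INR (Z.to_nat z) * T) by (unfold s; ring).
    destruct (P (Z.to_nat z) s). auto.
  - replace (t - IZR z * T) with (t + INR (Z.to_nat (- z)) * T); [apply P|].
    rewrite INR_IZR_INZ, Z2Nat.id by lia. rewrite opp_IZR. ring.
Qed.

(** * Truncation and the center of the Lienard form *)

Definition clamp (r x : R) : R := Rmax (- r) (Rmin r x).

Lemma clamp_abs_le r x : 0 <= r -> Rabs (clamp r x) <= r.
Proof.
  intros. apply Rabs_le. unfold clamp, Rmax, Rmin.
  repeat destruct (Rle_dec _ _); lra.
Qed.

Lemma clamp_lipschitz r x y : 0 <= r -> Rabs (clamp r x - clamp r y) <= Rabs (x - y).
Proof.
  intros. unfold clamp, Rmax, Rmin, Rabs.
  repeat destruct (Rle_dec _ _); repeat destruct (Rcase_abs _); lra.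
Qed.

(** Oddness is what lets the truncated field keep the reflection symmetries. *)
Lemma clamp_opp r x : 0 <= r -> clamp r (- x) = - clamp r x.
Proof.
  intros. unfold clamp, Rmax, Rmin. repeat destruct (Rle_dec _ _); lra.
Qed.

Lemma clamp_id r x : Rabs x <= r -> clamp r x = x.
Proof.
  intros H. apply Rabs_le_between in H. unfold clamp, Rmax, Rmin.
  repeat destruct (Rle_dec _ _); lra.
Qed.

Definition nonlin (al be ga y u : R) : R := be * y ^ 2 + ga * y ^ 3 + al * y * u.

(** Every monomial has degree at least two, so its difference is a coordinate difference times a
    factor of order [r]; surplus powers of [r] are absorbed by [r <= 1]. The constant thus tends to
    zero with [r]. *)
Lemma nonlin_lipschitz al be ga r y u y' u' :
  r <= 1 -> Rabs y <= r -> Rabs u <= r -> Rabs y' <= r -> Rabs u' <= r ->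
  Rabs (nonlin al be ga y u - nonlin al be ga y' u') <=
    r * (2 * Rabs be + 3 * Rabs ga + Rabs al) * (Rabs (y - y') + Rabs (u - u')).
Proof.
  intros r1 Hy Hu Hy' Hu'. unfold nonlin.
  replace (_ - _) with (be * ((y + y') * (y - y')) + ga * ((y * y + y * y' + y' * y') * (y - y'))
     + al * (y * (u - u') + (y - y') * u')) by ring.
  assert (r0 : 0 <= r) by (generalize (Rabs_pos y); lra).
  set (a := y - y'). set (b := u - u').
  assert (a0 := Rabs_pos a). assert (b0 := Rabs_pos b).
  assert (T1 : Rabs ((y + y') * a) <= 2 * r * (Rabs a + Rabs b)).
  { rewrite Rabs_mult. generalize (Rabs_triang y y') (Rabs_pos (y + y')). nra. }
  assert (T2 : Rabs ((y * y + y * y' + y' * y') * a) <= 3 * r * (Rabs a + Rabs b)).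
  { rewrite Rabs_mult.
    assert (Q : forall s t, Rabs s <= r -> Rabs t <= r -> Rabs (s * t) <= r).
    { intros s t Hs Ht. rewrite Rabs_mult. generalize (Rabs_pos s) (Rabs_pos t). nra. }
    generalize (Q y y Hy Hy) (Q y y' Hy Hy') (Q y' y' Hy' Hy')
      (Rabs_triang (y * y + y * y') (y' * y')) (Rabs_triang (y * y) (y * y'))
      (Rabs_pos (y * y + y * y' + y' * y')). intros.
    apply Rmult_le_compat; lra. }
  assert (T3 : Rabs (y * b + a * u') <= r * (Rabs a + Rabs b)).
  { eapply Rle_trans; [apply Rabs_triang|]. rewrite !Rabs_mult. nra. }
  eapply Rle_trans; [apply Rabs_triang|].
  eapply Rle_trans; [apply Rplus_le_compat_r, Rabs_triang|].
  rewrite (Rabs_mult be), (Rabs_mult ga), (Rabs_mult al).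
  generalize (Rabs_pos be) (Rabs_pos ga) (Rabs_pos al). intros.
  apply Rmult_le_compat_l with (r := Rabs be) in T1; trivial.
  apply Rmult_le_compat_l with (r := Rabs ga) in T2; trivial.
  apply Rmult_le_compat_l with (r := Rabs al) in T3; trivial. lra.
Qed.

Lemma abs_le_of_sq_sum r a b : 0 <= r -> a ^ 2 + b ^ 2 <= r ^ 2 -> Rabs a <= r /\ Rabs b <= r.
Proof.
  intros r0 H. split; apply Rabs_le; split; nra.
Qed.

Lemma lienard_center (om al be ga : R) :
  0 < om -> al = 0 \/ be = 0 ->
  exists d, 0 < d /\ forall y0 u0, y0 ^ 2 + u0 ^ 2 < d ^ 2 ->
    exists (y u : R -> R) (T : R), 0 < T /\
      is_solution (fun _ u => - u) (fun y u => om * y + nonlin al be ga y u) y u /\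
      y 0 = y0 /\ u 0 = u0 /\ (forall t, y (t + T) = y t /\ u (t + T) = u t).
Proof.
  intros om0 sym.
  set (m := Rmin 1 om).
  assert (m0 : 0 < m) by (unfold m, Rmin; destruct (Rle_dec _ _); lra).
  assert (m1 : m <= 1) by apply Rmin_l. assert (mo : m <= om) by apply Rmin_r.
  set (S := 2 * Rabs be + 3 * Rabs ga + Rabs al).
  assert (S0 : 0 <= S).
  { unfold S. generalize (Rabs_pos be) (Rabs_pos ga) (Rabs_pos al). lra. }
  (* The truncated nonlinear part gets a Lipschitz constant [r * S <= m / 4], small against the
     angular velocity [m] of the linear part; [S + 1] keeps the denominator positive. *)
  set (r := m / (4 * (S + 1))).
  assert (r0 : 0 < r) by (apply Rdiv_lt_0_compat; lra).
  assert (rS : r * S <= m / 4).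
  { replace (m / 4) with (r * (S + 1)) by (unfold r; field; lra). nra. }
  assert (r1 : r <= 1).
  { assert (r * (S + 1) = m / 4) by (unfold r; field; lra). nra. }
  set (N := fun y u => nonlin al be ga (clamp r y) (clamp r u)).
  set (e := r * S).
  assert (e0 : 0 <= e) by (unfold e; nra).
  assert (LN : lipschitz2 e N).
  { intros y u y' u'. unfold N.
    eapply Rle_trans; [apply nonlin_lipschitz with (r := r); trivial; apply clamp_abs_le; lra|].
    apply Rmult_le_compat_l; [exact e0|].
    apply Rplus_le_compat; apply clamp_lipschitz; lra. }
  assert (c0 : clamp r 0 = 0) by (apply clamp_id; rewrite Rabs_R0; lra).
  assert (N0 : N 0 0 = 0) by (unfold N, nonlin; rewrite c0; ring).
  set (f := fun _ u : R => - u). set (g := fun y u => om * y + N y u).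
  set (L := 1 + om + e).
  assert (Lf : lipschitz2 L f).
  { intros y u y' u'. unfold f, L. replace (- u - - u') with (- (u - u')) by ring.
    rewrite Rabs_Ropp. generalize (Rabs_pos (y - y')) (Rabs_pos (u - u')). nra. }
  assert (Lg : lipschitz2 L g).
  { intros y u y' u'. unfold g, L. specialize (LN y u y' u').
    replace (_ - _) with (om * (y - y') + (N y u - N y' u')) by ring.
    eapply Rle_trans; [apply Rabs_triang|]. rewrite Rabs_mult, (Rabs_pos_eq om) by lra.
    generalize (Rabs_pos (y - y')) (Rabs_pos (u - u')). nra. }
  (* The linear part contributes [om * y ^ 2 + u ^ 2], at least [m * (y ^ 2 + u ^ 2)], and the
     nonlinear part takes away at most half of this. *)
  assert (rot : forall y u, m / 2 * (y ^ 2 + u ^ 2) <= y * g y u - u * f y u).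
  { intros y u. unfold f, g. specialize (LN y u 0 0). rewrite N0, !Rminus_0_r in LN.
    assert (B : Rabs (y * N y u) <= m / 2 * (y ^ 2 + u ^ 2)).
    { rewrite Rabs_mult, <- (pow2_abs y), <- (pow2_abs u).
      assert (a0 := Rabs_pos y). assert (b0 := Rabs_pos u).
      set (a := Rabs y) in *. set (b := Rabs u) in *.
      apply Rle_trans with (a * (e * (a + b))); [now apply Rmult_le_compat_l|].
      apply Rle_trans with (a * (m / 4 * (a + b))).
      - apply Rmult_le_compat_l; trivial. apply Rmult_le_compat_r; [lra|exact rS].
      - assert (0 <= (a - b) ^ 2) by apply pow2_ge_0. nra. }
    apply Rabs_le_between in B.
    assert (0 <= y ^ 2) by apply pow2_ge_0. assert (0 <= u ^ 2) by apply pow2_ge_0. nra. }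
  (* For [al = 0] the reversor is [u -> - u]; for [be = 0] it is [y -> - y]. *)
  assert (rev : exists e, (e = 1 \/ e = -1) /\ reversible e f g).
  { destruct sym as [->| ->].
    - exists 1. split; [now left|]. intros y u. unfold f, g, N, nonlin.
      rewrite !Rmult_1_l. split; ring.
    - exists (-1). split; [now right|]. intros y u. unfold f, g, N, nonlin.
      replace (-1 * y) with (- y) by ring. replace (- (-1) * u) with u by ring.
      rewrite clamp_opp by lra. split; ring. }
  destruct rev as [sg [sg1 rev]].
  (* Largest growth factor of the squared distance to the origin over one period, whence the
     starting radius [r / sqrt E]. *)
  set (E := exp (4 * L * (12 * PI / (m / 2)))).
  assert (E0 : 0 < E) by apply exp_pos.
  exists (r / sqrt E). split.
  { apply Rdiv_lt_0_compat; trivial. now apply sqrt_lt_R0. }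
  intros y0 u0 H.
  assert (H' : (y0 ^ 2 + u0 ^ 2) * E < r ^ 2).
  { assert (EE : (r / sqrt E) ^ 2 * E = r ^ 2).
    { unfold Rdiv. rewrite Rpow_mult_distr, pow_inv, pow2_sqrt by lra. field. lra. }
    rewrite <- EE. now apply Rmult_lt_compat_r. }
  destruct (lipschitz_solution_exists f g L y0 u0 Lf Lg) as [y [u [So [Iy Iu]]]].
  destruct (reversible_rotation_periodic f g L sg (m / 2) y u) as [T [[T0 T1] P]]; trivial.
  { lra. }
  (* The time is moved into one period and the orbit compared with the zero solution. The orbit
     therefore stays where [clamp] is the identity and solves the original system. *)
  assert (small : forall t, Rabs (y t) <= r /\ Rabs (u t) <= r).
  { intros t. destruct (periodic_reduce y u T T0 P t) as [s [[s0 s1] [<- <-]]].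
    apply abs_le_of_sq_sum; [lra|].
    assert (Z : is_solution f g (fun _ => 0) (fun _ => 0)).
    { intros z. unfold f, g. rewrite N0. replace (om * 0 + 0) with 0 by ring. rewrite Ropp_0.
      split; apply derivable_pt_lim_const. }
    assert (D := solution_distance_le f g L y u _ _ Lf Lg So Z 0 s).
    simpl in D. rewrite Iy, Iu, !Rminus_0_r in D.
    left. eapply Rle_lt_trans; [|exact H'].
    eapply Rle_trans; [exact D|].
    apply Rmult_le_compat_l; [nra|].
    assert (EL : 4 * L * Rabs s <= 4 * L * (12 * PI / (m / 2))).
    { rewrite Rabs_pos_eq by lra. apply Rmult_le_compat_l; unfold L; lra. }
    unfold E. destruct EL as [EL|EL]; [left; now apply exp_increasing|right; now rewrite EL]. }
  exists y, u, T. split; [exact T0|]. split; [|split; [|split]]; trivial.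
  intros t. destruct (small t) as [B1 B2]. destruct (So t) as [D1 D2].
  unfold f, g, N in D1, D2. rewrite !clamp_id in D2 by trivial. now split.
Qed.

(** * Lyapunov function of the focus *)

(** The hitting time is the supremum of the times up to which [phi] has stayed below [b]; continuity
    excludes both [phi m < b] and [phi m > b]. *)
Lemma first_hit (phi : R -> R) (b t1 : R) :
  continuity phi -> phi 0 < b -> 0 <= t1 -> b <= phi t1 ->
  exists t, 0 < t /\ phi t = b /\ forall s, 0 <= s < t -> phi s < b.
Proof.
  intros C H0 t10 H1.
  set (E := fun t => 0 <= t /\ forall s, 0 <= s <= t -> phi s < b).
  destruct (completeness E) as [m [ub lub]].
  - exists t1. intros t [t0 Ht]. destruct (Rle_dec t t1) as [|n]; trivial.
    exfalso. assert (phi t1 < b) by (apply Ht; lra). lra.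
  - exists 0. split; [lra|]. intros s Hs. now replace s with 0 by lra.
  - assert (m0 : 0 <= m).
    { apply ub. split; [lra|]. intros s Hs. now replace s with 0 by lra. }
    assert (below : forall s, 0 <= s < m -> phi s < b).
    { intros s Hs. apply NNPP. intros N.
      enough (m <= s) by lra. apply lub. intros t [t0 Ht].
      destruct (Rle_dec t s) as [|n]; trivial. exfalso. apply N, Ht. lra. }
    assert (mge : b <= phi m).
    { destruct (Rle_dec b (phi m)) as [|n]; trivial. exfalso.
      destruct (C m (b - phi m) ltac:(lra)) as [d [d0 Hd]].
      assert (Em : E (m + d / 2)).
      { split; [lra|]. intros s Hs. destruct (Rlt_dec s m) as [|sm]; [apply below; lra|].
        destruct (Req_dec s m) as [->|ne]; [lra|].
        assert (B : Rabs (phi s - phi m) < b - phi m).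
        { apply Hd. split.
          - split; [exact I|auto].
          - simpl. unfold Rdist. rewrite Rabs_pos_eq; lra. }
        apply Rabs_def2 in B. lra. }
      apply ub in Em. lra. }
    assert (mpos : 0 < m).
    { destruct m0 as [|<-]; trivial. lra. }
    exists m. split; [exact mpos|]. split; [|exact below].
    apply Rle_antisym; [|exact mge].
    destruct (Rle_dec (phi m) b) as [|n]; trivial. exfalso.
    destruct (C m (phi m - b) ltac:(lra)) as [d [d0 Hd]].
    set (s := Rmax (m / 2) (m - d / 2)).
    assert (Hs : m / 2 <= s /\ m - d / 2 <= s /\ s < m).
    { unfold s. split; [apply Rmax_l|]. split; [apply Rmax_r|]. apply Rmax_lub_lt; lra. }
    assert (B : Rabs (phi s - phi m) < phi m - b).
    { apply Hd. split.
      - split; [exact I|]. lra.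
      - simpl. unfold Rdist. rewrite Rabs_left; lra. }
    apply Rabs_def2 in B. specialize (below s). lra.
Qed.

(** On the circle of radius [r], [V] is at least [c * r ^ 2], which exceeds its initial value, so
    the orbit is trapped inside. There [V] does not increase, and a return to the start would make
    it constant, against [D < 0] away from the origin. *)
Lemma lyapunov_not_periodic (V D : R -> R -> R) (c r T : R) (y w : R -> R) :
  0 < c -> 0 < r ->
  (forall a b, a ^ 2 + b ^ 2 <= r ^ 2 -> c * (a ^ 2 + b ^ 2) <= V a b) ->
  V 0 0 = 0 ->
  (forall a b, a ^ 2 + b ^ 2 <= r ^ 2 -> D a b <= 0) ->
  (forall a b, 0 < a ^ 2 + b ^ 2 <= r ^ 2 -> D a b < 0) ->
  continuity y -> continuity w ->
  (forall t, derivable_pt_lim (fun t => V (y t) (w t)) t (D (y t) (w t))) ->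
  y 0 ^ 2 + w 0 ^ 2 < r ^ 2 -> 0 < V (y 0) (w 0) < c * r ^ 2 ->
  0 < T -> y T = y 0 -> w T = w 0 -> False.
Proof.
  intros c0 r0 Vge V0 Dle Dlt Cy Cw DV I0 V1 T0 yT wT.
  assert (stay : forall t, 0 <= t -> y t ^ 2 + w t ^ 2 < r ^ 2).
  { intros t t0. destruct (Rlt_dec (y t ^ 2 + w t ^ 2) (r ^ 2)) as [|n]; trivial. exfalso.
    destruct (first_hit (fun t => y t ^ 2 + w t ^ 2) (r ^ 2) t) as [m [m0 [Em Bm]]]; trivial; [|lra|].
    { intros z. apply (continuity_pt_plus (fun t => y t ^ 2) (fun t => w t ^ 2)).
      - apply (continuity_pt_comp y (fun a => a ^ 2)); [apply Cy|].
        apply derivable_continuous_pt, derivable_pt_pow.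
      - apply (continuity_pt_comp w (fun a => a ^ 2)); [apply Cw|].
        apply derivable_continuous_pt, derivable_pt_pow. }
    destruct (MVT_cor2 _ _ 0 m m0 (fun z _ => DV z)) as [z [E Iz]].
    specialize (Bm z ltac:(lra)). specialize (Dle (y z) (w z) ltac:(lra)).
    specialize (Vge (y m) (w m) ltac:(lra)). rewrite Em in Vge. nra. }
  assert (mono : forall s t, 0 <= s < t -> V (y t) (w t) <= V (y s) (w s)).
  { intros s t st.
    destruct (MVT_cor2 _ _ s t (proj2 st) (fun z _ => DV z)) as [z [E Iz]].
    assert (B := stay z ltac:(lra)). specialize (Dle (y z) (w z) ltac:(lra)). nra. }
  destruct (MVT_cor2 _ _ 0 T T0 (fun z _ => DV z)) as [z [E Iz]].
  assert (M1 := mono 0 z ltac:(lra)). assert (M2 := mono z T ltac:(lra)).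
  rewrite yT, wT in *.
  assert (B := stay z ltac:(lra)).
  (* Monotonicity on both sides of [z] forces [V] at time [z] to equal its positive initial value,
     so the orbit is not at the origin there. *)
  assert (P : 0 < y z ^ 2 + w z ^ 2).
  { assert (0 <= y z ^ 2) by apply pow2_ge_0. assert (0 <= w z ^ 2) by apply pow2_ge_0.
    destruct (Req_dec (y z ^ 2 + w z ^ 2) 0) as [e|]; [|lra]. exfalso.
    assert (y z = 0) by nra. assert (w z = 0) by nra.
    replace (y z) with 0 in * by lra. replace (w z) with 0 in * by lra. lra. }
  specialize (Dlt (y z) (w z) ltac:(lra)). nra.
Qed.

(** Six is the number of remainder monomials both in [lyap] and in [lyap_dot]. *)
Lemma abs_sum6_le (a1 a2 a3 a4 a5 a6 m1 m2 m3 m4 m5 m6 b : R) :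
  Rabs m1 <= b -> Rabs m2 <= b -> Rabs m3 <= b ->
  Rabs m4 <= b -> Rabs m5 <= b -> Rabs m6 <= b ->
  Rabs (a1 * m1 + a2 * m2 + a3 * m3 + a4 * m4 + a5 * m5 + a6 * m6) <=
  (Rabs a1 + Rabs a2 + Rabs a3 + Rabs a4 + Rabs a5 + Rabs a6) * b.
Proof.
  intros.
  assert (P : forall a m, Rabs m <= b -> Rabs (a * m) <= Rabs a * b).
  { intros a m H'. rewrite Rabs_mult. apply Rmult_le_compat_l; trivial. apply Rabs_pos. }
  do 5 (eapply Rle_trans; [apply Rabs_triang|]; rewrite ?Rmult_plus_distr_r;
    apply Rplus_le_compat; [|now apply P]).
  now apply P.
Qed.

(** With [M] the larger of [Rabs y] and [Rabs w], the monomial is at most [M ^ (i + j)]: here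
    [2 * k] factors are bounded through [M ^ 2 <= y ^ 2 + w ^ 2], one factor by [r], and the others
    by [1]. *)
Lemma monomial_abs_le (r y w : R) (k i j : nat) :
  r <= 1 -> Rabs y <= r -> Rabs w <= r -> (2 * k + 1 <= i + j)%nat ->
  Rabs (y ^ i * w ^ j) <= r * (y ^ 2 + w ^ 2) ^ k.
Proof.
  intros r1 Hy Hw ij.
  rewrite Rabs_mult, <- !RPow_abs, <- (pow2_abs y), <- (pow2_abs w).
  assert (0 <= Rabs y) by apply Rabs_pos. assert (0 <= Rabs w) by apply Rabs_pos.
  set (a := Rabs y) in *. set (b := Rabs w) in *.
  set (M := Rmax a b).
  assert (M2 : M ^ 2 <= a ^ 2 + b ^ 2).
  { unfold M, Rmax. destruct (Rle_dec a b); nra. }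
  assert (Mr : 0 <= M <= r).
  { unfold M, Rmax. destruct (Rle_dec a b); lra. }
  apply Rle_trans with (M ^ i * M ^ j).
  { apply Rmult_le_compat; try (apply pow_le; trivial); apply pow_incr; split; trivial;
    unfold M; [apply Rmax_l|apply Rmax_r]. }
  rewrite <- pow_add.
  replace (i + j)%nat with (2 * k + (1 + (i + j - (2 * k + 1))))%nat by lia.
  rewrite !pow_add, pow_mult, pow_1.
  set (l := (i + j - (2 * k + 1))%nat).
  assert (Q : 0 <= M ^ l <= 1).
  { split; [apply pow_le; lra|]. rewrite <- (pow1 l). apply pow_incr. lra. }
  assert (Qk : 0 <= (M ^ 2) ^ k <= (a ^ 2 + b ^ 2) ^ k).
  { split; [apply pow_le; nra|]. apply pow_incr. nra. }
  rewrite (Rmult_comm r). apply Rmult_le_compat; try lra; [|nra].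
  apply Rmult_le_pos; lra.
Qed.

Lemma small_radius (S k : R) : 0 <= S -> 0 < k -> exists r, 0 < r <= 1 /\ r * S <= k.
Proof.
  intros S0 k0. exists (Rmin 1 (k / (S + 1))).
  assert (q : 0 < k / (S + 1)) by (apply Rdiv_lt_0_compat; lra).
  assert (A := Rmin_l 1 (k / (S + 1))). assert (B := Rmin_r 1 (k / (S + 1))).
  assert (C : 0 < Rmin 1 (k / (S + 1))) by (apply Rmin_pos; lra).
  split; [lra|].
  replace k with (k / (S + 1) * (S + 1)) at 2 by (field; lra). nra.
Qed.

(* The first four terms are the energy, whose derivative is [al / 2 * y ^ 2 * w'].
   The cubic correction cancels the [y ^ 3] term of this derivative, and the quartic
   ones turn its quartic part into a definite form with the sign of [- al * be]. *)
Definition lyap (om al be ga y w : R) : R :=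
  w ^ 2 / 2 + om * y ^ 2 / 2 + be * y ^ 3 / 3 + ga * y ^ 4 / 4
  - al / 2 * (y ^ 2 * w + 2 / (3 * om) * w ^ 3) - al ^ 2 / 8 * y ^ 4
  - al * be / (12 * om) * (y ^ 3 * w) + al * be / (12 * om ^ 2) * (y * w ^ 3).

(** The derivative of [lyap] along the field, split into its quartic form and the terms of degrees
    five and six. Trivial powers such as [w ^ 0] are written out to match [monomial_abs_le]. *)
Definition lyap_dot (om al be ga y w : R) : R :=
  - (al * be / om) * (w ^ 2 * y ^ 2 / 2 + om * y ^ 4 / 12 + w ^ 4 / (12 * om)) +
  ((- al ^ 3 / 4 - al * be ^ 2 / (12 * om)) * (y ^ 5 * w ^ 0)
   + (- al ^ 2 * be / (8 * om)) * (y ^ 4 * w ^ 1)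
   + (al ^ 2 * be / (24 * om ^ 2)) * (y ^ 2 * w ^ 3)
   + (- al * ga / om + al * be ^ 2 / (4 * om ^ 2)) * (y ^ 3 * w ^ 2)
   + (- al * be * ga / (12 * om)) * (y ^ 6 * w ^ 0)
   + (al * be * ga / (4 * om ^ 2)) * (y ^ 4 * w ^ 2)).

Lemma lyap_derive om al be ga (y w : R -> R) t :
  0 < om ->
  is_solution (fun y w => - w + al / 2 * y ^ 2)
    (fun y w => om * y + be * y ^ 2 + ga * y ^ 3) y w ->
  derivable_pt_lim (fun t => lyap om al be ga (y t) (w t)) t (lyap_dot om al be ga (y t) (w t)).
Proof.
  intros om0 S. destruct (S t) as [D1 D2]. apply is_derive_Reals in D1, D2.
  apply is_derive_Reals. unfold lyap, lyap_dot.
  derive_by_hyps. field. lra.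
Qed.

(** The terms beyond the quadratic energy have degree three or four, so they gain a factor [r];
    [lyap] is then positive definite near the origin. *)
Lemma lyap_near om al be ga :
  0 < om ->
  exists S, 0 <= S /\ forall r y w, r <= 1 -> Rabs y <= r -> Rabs w <= r ->
    Rabs (lyap om al be ga y w - (w ^ 2 / 2 + om * y ^ 2 / 2)) <= r * S * (y ^ 2 + w ^ 2).
Proof.
  intros om0.
  exists (Rabs (be / 3) + Rabs (- al / 2) + Rabs (- al / (3 * om)) + Rabs (ga / 4 - al ^ 2 / 8)
    + Rabs (- (al * be / (12 * om))) + Rabs (al * be / (12 * om ^ 2))).
  split; [repeat apply Rplus_le_le_0_compat; apply Rabs_pos|].
  intros r y w r1 Hy Hw.
  replace (lyap om al be ga y w - (w ^ 2 / 2 + om * y ^ 2 / 2)) with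
    (be / 3 * (y ^ 3 * w ^ 0) + - al / 2 * (y ^ 2 * w ^ 1) + - al / (3 * om) * (y ^ 0 * w ^ 3)
     + (ga / 4 - al ^ 2 / 8) * (y ^ 4 * w ^ 0) + - (al * be / (12 * om)) * (y ^ 3 * w ^ 1)
     + al * be / (12 * om ^ 2) * (y ^ 1 * w ^ 3)).
  2:{ unfold lyap. field. lra. }
  rewrite (Rmult_comm r), Rmult_assoc, <- (pow_1 (y ^ 2 + w ^ 2)).
  apply abs_sum6_le; apply monomial_abs_le; trivial; lia.
Qed.

(** The quartic form is negative definite because [al * be > 0], and the terms of higher degree gain
    a factor [r] over it. *)
Lemma lyap_dot_neg om al be ga :
  0 < om -> 0 < al * be ->
  exists k S, 0 < k /\ 0 <= S /\ forall r y w, r <= 1 -> Rabs y <= r -> Rabs w <= r ->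
    lyap_dot om al be ga y w <= (r * S - k) * (y ^ 2 + w ^ 2) ^ 2.
Proof.
  intros om0 ab0.
  (* A common lower bound for the coefficients of [y ^ 4 / 12] and [w ^ 4 / 12]. The [24] below
     arises from [(y ^ 2 + w ^ 2) ^ 2 <= 2 * (y ^ 4 + w ^ 4)]. *)
  set (mu := Rmin om (/ om)).
  assert (io := Rinv_0_lt_compat _ om0).
  assert (mu0 : 0 < mu) by now apply Rmin_pos.
  assert (mu1 : mu <= om) by apply Rmin_l. assert (mu2 : mu <= / om) by apply Rmin_r.
  assert (c0 : 0 < al * be / om) by now apply Rdiv_lt_0_compat.
  exists (al * be / om * (mu / 24)),
    (Rabs (- al ^ 3 / 4 - al * be ^ 2 / (12 * om)) + Rabs (- al ^ 2 * be / (8 * om))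
     + Rabs (al ^ 2 * be / (24 * om ^ 2)) + Rabs (- al * ga / om + al * be ^ 2 / (4 * om ^ 2))
     + Rabs (- al * be * ga / (12 * om)) + Rabs (al * be * ga / (4 * om ^ 2))).
  split; [apply Rmult_lt_0_compat; lra|].
  split; [repeat apply Rplus_le_le_0_compat; apply Rabs_pos|].
  intros r y w r1 Hy Hw. unfold lyap_dot.
  set (n := y ^ 2 + w ^ 2).
  set (S := Rabs _ + _ + _ + _ + _ + _).
  set (Rm := _ + _ + _ + _ + _ + _).
  assert (B : Rabs Rm <= S * (r * n ^ 2)).
  { apply abs_sum6_le; apply monomial_abs_le; trivial; lia. }
  apply Rabs_le_between in B.
  assert (Q : mu / 24 * n ^ 2 <= w ^ 2 * y ^ 2 / 2 + om * y ^ 4 / 12 + w ^ 4 / (12 * om)).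
  { replace (w ^ 4 / (12 * om)) with (/ om * w ^ 4 / 12) by (field; lra).
    assert (0 <= y ^ 4) by (replace (y ^ 4) with ((y ^ 2) ^ 2) by ring; apply pow2_ge_0).
    assert (0 <= w ^ 4) by (replace (w ^ 4) with ((w ^ 2) ^ 2) by ring; apply pow2_ge_0).
    assert (0 <= w ^ 2 * y ^ 2) by (apply Rmult_le_pos; apply pow2_ge_0).
    assert (0 <= (y ^ 2 - w ^ 2) ^ 2) by apply pow2_ge_0.
    assert (mu * y ^ 4 <= om * y ^ 4) by now apply Rmult_le_compat_r.
    assert (mu * w ^ 4 <= / om * w ^ 4) by now apply Rmult_le_compat_r.
    assert (mu * n ^ 2 <= mu * (2 * (y ^ 4 + w ^ 4))).
    { apply Rmult_le_compat_l; [lra|]. unfold n. nra. }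
    lra. }
  apply Rmult_le_compat_l with (r := al * be / om) in Q; lra.
Qed.

Lemma focus_not_periodic_pos om al be ga :
  0 < om -> 0 < al * be ->
  exists d, 0 < d /\ forall (y w : R -> R) T,
    is_solution (fun y w => - w + al / 2 * y ^ 2)
      (fun y w => om * y + be * y ^ 2 + ga * y ^ 3) y w ->
    y 0 = 0 -> 0 < Rabs (w 0) < d -> 0 < T -> y T = y 0 -> w T = w 0 -> False.
Proof.
  intros om0 ab0.
  destruct (lyap_near om al be ga om0) as [S1 [S10 H1]].
  destruct (lyap_dot_neg om al be ga om0 ab0) as [k [S2 [k0 [S20 H2]]]].
  set (m := Rmin 1 om).
  assert (m0 : 0 < m) by (apply Rmin_pos; lra).
  assert (m1 : m <= 1) by apply Rmin_l. assert (mo : m <= om) by apply Rmin_r.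
  (* The errors may consume half of the energy, which is at least [m / 2] times the squared norm,
     and half of the dissipation rate [k]. *)
  destruct (small_radius S1 (m / 4)) as [r1 [R1 E1]]; [lra..|].
  destruct (small_radius S2 (k / 2)) as [r2 [R2 E2]]; [lra..|].
  set (r := Rmin r1 r2).
  assert (r0 : 0 < r) by (apply Rmin_pos; lra).
  assert (rr1 : r <= r1) by apply Rmin_l. assert (rr2 : r <= r2) by apply Rmin_r.
  assert (F1 : r * S1 <= m / 4) by (apply Rle_trans with (r1 * S1); [now apply Rmult_le_compat_r|lra]).
  assert (F2 : r * S2 <= k / 2) by (apply Rle_trans with (r2 * S2); [now apply Rmult_le_compat_r|lra]).
  assert (V1 : forall a b, a ^ 2 + b ^ 2 <= r ^ 2 ->
    Rabs (lyap om al be ga a b - (b ^ 2 / 2 + om * a ^ 2 / 2)) <= m / 4 * (a ^ 2 + b ^ 2)).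
  { intros a b H. destruct (abs_le_of_sq_sum r a b) as [A B]; [lra|trivial|].
    eapply Rle_trans; [apply H1 with (r := r); trivial; lra|].
    apply Rmult_le_compat_r; trivial. generalize (pow2_ge_0 a) (pow2_ge_0 b). lra. }
  assert (D1 : forall a b, a ^ 2 + b ^ 2 <= r ^ 2 ->
    lyap_dot om al be ga a b <= - (k / 2) * (a ^ 2 + b ^ 2) ^ 2).
  { intros a b H. destruct (abs_le_of_sq_sum r a b) as [A B]; [lra|trivial|].
    eapply Rle_trans; [apply H2 with (r := r); trivial; lra|].
    apply Rmult_le_compat_r; [apply pow2_ge_0|lra]. }
  (* As [m <= 1], this gives [w 0 ^ 2 < m / 4 * r ^ 2], while the initial value of [lyap] is at most
     [3 / 4 * w 0 ^ 2], hence below the trapping level [m / 4 * r ^ 2]. *)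
  exists (r * m / 4). split; [nra|].
  intros y w T So y0 w0 T0 yT wT.
  assert (w2 : 0 < w 0 ^ 2 < m / 4 * r ^ 2).
  { rewrite <- pow2_abs. split; [apply pow_lt; lra|].
    apply Rlt_le_trans with ((r * m / 4) ^ 2); [|nra].
    assert (0 < r * m / 4) by nra. nra. }
  assert (w2r : 0 ^ 2 + w 0 ^ 2 < r ^ 2) by nra.
  apply (lyapunov_not_periodic (lyap om al be ga) (lyap_dot om al be ga) (m / 4) r T y w);
    trivial; try lra.
  - intros a b H. specialize (V1 a b H). apply Rabs_le_between in V1.
    assert (0 <= (om - m) * a ^ 2) by (apply Rmult_le_pos; [lra|apply pow2_ge_0]).
    assert (0 <= (1 - m) * b ^ 2) by (apply Rmult_le_pos; [lra|apply pow2_ge_0]). lra.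
  - unfold lyap. field. lra.
  - intros a b H. specialize (D1 a b H). assert (0 <= (a ^ 2 + b ^ 2) ^ 2) by apply pow2_ge_0. nra.
  - intros a b [H0 H]. specialize (D1 a b H).
    assert (0 < (a ^ 2 + b ^ 2) ^ 2) by now apply pow_lt. nra.
  - intros t. apply derivable_continuous_pt. eexists. apply (proj1 (So t)).
  - intros t. apply derivable_continuous_pt. eexists. apply (proj2 (So t)).
  - intros t. now apply lyap_derive.
  - rewrite y0. exact w2r.
  - rewrite y0. specialize (V1 0 (w 0) ltac:(lra)). apply Rabs_le_between in V1. nra.
Qed.

Lemma focus_not_periodic om al be ga :
  0 < om -> al * be <> 0 ->
  exists d, 0 < d /\ forall (y w : R -> R) T,
    is_solution (fun y w => - w + al / 2 * y ^ 2)
      (fun y w => om * y + be * y ^ 2 + ga * y ^ 3) y w ->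
    y 0 = 0 -> 0 < Rabs (w 0) < d -> 0 < T ->
    (forall t, y (t + T) = y t /\ w (t + T) = w t) -> False.
Proof.
  intros om0 ab.
  destruct (Rlt_dec 0 (al * be)) as [pos|neg].
  - destruct (focus_not_periodic_pos om al be ga om0 pos) as [d [d0 H]].
    exists d. split; trivial. intros y w T So y0 w0 T0 P.
    destruct (P 0) as [Py Pw]. rewrite Rplus_0_l in Py, Pw. now apply (H y w T).
  - (* [(y, w, t) |-> (y, - w, - t)] changes the sign of [al]. *)
    destruct (focus_not_periodic_pos om (- al) be ga om0) as [d [d0 H]]; [lra|].
    exists d. split; trivial. intros y w T So y0 w0 T0 P.
    apply (H (fun t => y (- t)) (fun t => - w (- t)) T); trivial; rewrite ?Ropp_0; trivial.
    + intros t. destruct (So (- t)) as [D1 D2]. apply is_derive_Reals in D1, D2.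
      split; apply is_derive_Reals; derive_by_hyps; field.
    + now rewrite Rabs_Ropp.
    + destruct (P (- T)) as [<- _]. f_equal. ring.
    + destruct (P (- T)) as [_ <-]. f_equal. f_equal. ring.
Qed.

(** * The cubic system *)

(** A nonnegative discriminant would yield a real eigenvalue. Otherwise [tr / 2] is the real part of
    an eigenvalue, so the trace vanishes and the negative discriminant makes the determinant
    positive. *)
Lemma imaginary_eigs_iff j11 j12 j21 j22 :
  purely_imaginary_nonzero_eigs j11 j12 j21 j22 <->
  j11 + j22 = 0 /\ 0 < j11 * j22 - j12 * j21.
Proof.
  unfold purely_imaginary_nonzero_eigs, is_eigenvalue.
  set (tr := j11 + j22). set (det := j11 * j22 - j12 * j21). split.
  - intros H. destruct (Rle_dec 0 (tr ^ 2 - 4 * det)) as [ge|lt].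
    + exfalso. assert (Sq := pow2_sqrt _ ge). set (s := sqrt _) in *.
      destruct (H ((tr + s) / 2) 0) as [_ N]; [split; nra|]. now apply N.
    + assert (Sq := pow2_sqrt (4 * det - tr ^ 2) ltac:(lra)). set (s := sqrt _) in *.
      destruct (H (tr / 2) (s / 2)) as [E _]; [split; nra|]. split; nra.
  - intros [t0 d0] re im [E1 E2]. rewrite t0 in *.
    destruct (Req_dec im 0) as [->|n]; [nra|]. split; trivial. nra.
Qed.

Lemma cubic_linearization a0 a1 b1 b2 c1 c2 c3 :
  is_linearization (cubic_f a0 a1 c1 c2 c3) (cubic_g b1 b2) 0 0 a0 c1 (-1) (- b1).
Proof.
  unfold is_linearization, cubic_f, cubic_g, P1, P2, P3.
  repeat split; apply is_derive_Reals; auto_derive; trivial; ring.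
Qed.

Lemma is_linearization_unique f g x0 y0 j11 j12 j21 j22 k11 k12 k21 k22 :
  is_linearization f g x0 y0 j11 j12 j21 j22 -> is_linearization f g x0 y0 k11 k12 k21 k22 ->
  j11 = k11 /\ j12 = k12 /\ j21 = k21 /\ j22 = k22.
Proof.
  intros [A1 [A2 [A3 A4]]] [B1 [B2 [B3 B4]]].
  repeat split; eapply uniqueness_limite; eassumption.
Qed.

(** The second coordinate is [u + (a1 - 2 * b2) / 2 * y ^ 2] with [u = x + P2 b1 b2 y]; the [b2]
    terms cancel and leave [a1 / 2]. *)
Lemma cubic_to_lienard a0 a1 b1 b2 c1 c2 c3 (x y : R -> R) :
  a0 = b1 ->
  is_solution (cubic_f a0 a1 c1 c2 c3) (cubic_g b1 b2) x y ->
  is_solution (fun y w => - w + (a1 - 2 * b2) / 2 * y ^ 2)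
    (fun y w => (c1 - a0 * b1) * y + (c2 - a0 * (a1 + b2)) * y ^ 2 + (c3 - a1 * b2) * y ^ 3)
    y (fun t => x t + b1 * y t + a1 / 2 * y t ^ 2).
Proof.
  intros -> So t. destruct (So t) as [D1 D2]. unfold cubic_f, cubic_g, P1, P2, P3 in *.
  split.
  - replace (_ + _) with (- x t - (b1 * y t + b2 * y t ^ 2)) by field. exact D2.
  - apply is_derive_Reals in D1, D2. apply is_derive_Reals. derive_by_hyps. field.
Qed.

Lemma lienard_to_cubic a0 a1 b1 b2 c1 c2 c3 (y u : R -> R) :
  a0 = b1 ->
  is_solution (fun _ u => - u) (fun y u => (c1 - a0 * b1) * y +
    nonlin (a1 - 2 * b2) (c2 - a0 * (a1 + b2)) (c3 - a1 * b2) y u) y u ->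
  is_solution (cubic_f a0 a1 c1 c2 c3) (cubic_g b1 b2) (fun t => u t - P2 b1 b2 (y t)) y.
Proof.
  intros -> So t. destruct (So t) as [D1 D2]. unfold cubic_f, cubic_g, nonlin, P1, P2, P3 in *.
  split.
  - apply is_derive_Reals in D1, D2. apply is_derive_Reals. derive_by_hyps. ring.
  - replace (- _ - _) with (- u t) by ring. exact D1.
Qed.

Theorem theorem3 (a0 a1 b1 b2 c1 c2 c3 : R) :
  nondegenerate_center (cubic_f a0 a1 c1 c2 c3) (cubic_g b1 b2) 0 0 <->
  (a0 - b1 = 0 /\ c1 - a0 * b1 > 0 /\
   (a1 - 2 * b2 = 0 \/ c2 - a0 * (a1 + b2) = 0)).
Proof.
  assert (lin := cubic_linearization a0 a1 b1 b2 c1 c2 c3). split.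
  - intros [_ [[j11 [j12 [j21 [j22 [J eig]]]]] [eps [eps0 closed]]]].
    destruct (is_linearization_unique _ _ _ _ _ _ _ _ _ _ _ _ J lin) as [-> [-> [-> ->]]].
    apply imaginary_eigs_iff in eig. destruct eig as [tr det].
    split; [lra|]. split; [lra|].
    apply NNPP. intros N.
    assert (ab : (a1 - 2 * b2) * (c2 - a0 * (a1 + b2)) <> 0).
    { intros E. apply N. now apply Rmult_integral. }
    destruct (focus_not_periodic (c1 - a0 * b1) _ _ (c3 - a1 * b2) ltac:(lra) ab) as [d [d0 H]].
    set (p := Rmin (eps / 2) (d / 2)).
    assert (p0 : 0 < p) by (apply Rmin_pos; lra).
    assert (p1 : p <= eps / 2) by apply Rmin_l. assert (p2 : p <= d / 2) by apply Rmin_r.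
    (* At a starting point with [y = 0] the change of coordinates is the identity, so [w] starts at
       [p], within the range of [H]. *)
    destruct (closed p 0) as [x [y [T [T0 [So [Ix [Iy P]]]]]]]; [nra|].
    apply (H y (fun t => x t + b1 * y t + a1 / 2 * y t ^ 2) T); trivial.
    + apply cubic_to_lienard; trivial. lra.
    + rewrite Ix, Iy. replace (p + b1 * 0 + a1 / 2 * 0 ^ 2) with p by field.
      rewrite Rabs_pos_eq; lra.
    + intros t. destruct (P t) as [-> ->]. auto.
  - intros [tr [det sym]]. split; [|split].
    + unfold singular_point, cubic_f, cubic_g, P1, P2, P3. split; ring.
    + exists a0, c1, (-1), (- b1). split; trivial. apply imaginary_eigs_iff. lra.
    + destruct (lienard_center (c1 - a0 * b1) _ _ (c3 - a1 * b2) ltac:(lra) sym) as [d [d0 H]].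
      (* If [u0] is the initial value of [u], then [Rabs u0 <= C * eps], so [q ^ 2 + u0 ^ 2 <= eps ^
         2 * B < (eps * B) ^ 2 <= d ^ 2]; using [B > 1] avoids a square root. *)
      set (B := 1 + (1 + Rabs b1 + Rabs b2) ^ 2).
      assert (Bb1 := Rabs_pos b1). assert (Bb2 := Rabs_pos b2).
      set (C := 1 + Rabs b1 + Rabs b2) in *.
      assert (B1 : 1 < B).
      { unfold B. assert (0 < C ^ 2) by (apply pow_lt; unfold C; lra). lra. }
      (* The bound by [1] makes [q ^ 2 <= eps], so that [P2] is bounded linearly in [eps]. *)
      set (eps := Rmin 1 (d / B)).
      assert (q0 : 0 < d / B) by (apply Rdiv_lt_0_compat; lra).
      assert (e0 : 0 < eps) by (apply Rmin_pos; lra).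
      assert (e1 : eps <= 1) by apply Rmin_l.
      assert (e2 : eps * B <= d).
      { replace d with (d / B * B) by (field; lra).
        apply Rmult_le_compat_r; [lra|apply Rmin_r]. }
      exists eps. split; trivial. intros p q Hpq. rewrite !Rminus_0_r in Hpq.
      destruct (abs_le_of_sq_sum eps p q) as [Ap Aq]; [lra..|].
      assert (Au : Rabs (p + P2 b1 b2 q) <= C * eps).
      { unfold P2, C. eapply Rle_trans; [apply Rabs_triang|].
        assert (T1 := Rabs_triang (b1 * q) (b2 * q ^ 2)). rewrite !Rabs_mult in T1.
        assert (Rabs b1 * Rabs q <= Rabs b1 * eps) by now apply Rmult_le_compat_l.
        assert (Rabs (q ^ 2) <= eps).
        { rewrite <- RPow_abs. generalize (Rabs_pos q). nra. }
        assert (Rabs b2 * Rabs (q ^ 2) <= Rabs b2 * eps) by now apply Rmult_le_compat_l.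
        lra. }
      destruct (H q (p + P2 b1 b2 q)) as [y [u [T [T0 [So [Iy [Iu P]]]]]]].
      { rewrite <- (pow2_abs (p + _)).
        assert (Rabs (p + P2 b1 b2 q) ^ 2 <= (C * eps) ^ 2).
        { apply pow_incr. split; trivial. apply Rabs_pos. }
        assert (q ^ 2 <= eps ^ 2) by (generalize (pow2_ge_0 p); lra).
        assert (S1 : (eps * B) ^ 2 <= d ^ 2) by (apply pow_incr; nra).
        assert (S2 : eps ^ 2 * B < eps ^ 2 * B ^ 2).
        { apply Rmult_lt_compat_l; [now apply pow_lt|nra]. }
        unfold B in S2 at 1. nra. }
      exists (fun t => u t - P2 b1 b2 (y t)), y, T. split; trivial. split; [|split; [|split]].
      * apply lienard_to_cubic; trivial. lra.
      * rewrite Iu, Iy. ring.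
      * exact Iy.
      * intros t. destruct (P t) as [-> ->]. auto.
Qed.
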